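(* If $\mathcal{K}$ is a critical group of an arithmetical structure on the star graph $S_n$ (or on the complete graph $K_n$) for $n\geq 2$, then \[\lvert\mathcal{K}\rvert<\frac{n!}{2}\,a_{n-2}^2.\]
   Context: The sequence $a_n$ is defined by the recursion $a_n=a_{n-1}^2+a_{n-1}$ with $a_1=1$; its first few terms are $1,2,6,42,1806,3263442,\dotsc$. Equivalently, $a_n=s_n-1=\prod_{i=1}^{n-1}s_i$, where $s_n$ is the $n$-th term of Sylvester's sequence, given by $s_1=2$ and $s_{n+1}=s_n^2-s_n+1$. An arithmetical structure on a finite, connected, loopless graph $G$ with vertex set $V(G)$ is a pair $(\mathbf{d},\mathbf{r})$, where $\mathbf{r}=(r_v)_{v\in V(G)}$ consists of positive integers with no common factor, $\mathbf{d}=(d_v)_{v\in V(G)}$ consists of nonnegative integers, and for every vertex $v$ we have $r_vd_v=\sum r_u$, the sum being over all $u$ adjacent to $v$ (with multiplicity in the case of non-simple graphs). Its critical group is the torsion part of the cokernel (over $\mathbb{Z}$) of the matrix $\operatorname{diag}(\mathbf{d})-A(G)$, where $A(G)$ is the adjacency matrix of $G$ and $\operatorname{diag}(\mathbf{d})$ is the diagonal matrix with the vector $\mathbf{d}$ on the diagonal. The star graph $S_n$ has $n$ leaves, each joined by one edge to a single central vertex (and no other edges), so it has $n+1$ vertices. $K_n$ denotes the (simple) complete graph on $n$ vertices.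
   Formalization: The formal theorem assumes n ≥ 4 instead of n ≥ 2: for n = 2 the term a_0 is undefined, and for n = 3 the strict bound 3 fails, since K_3 with r = (1,1,1), d = (2,2,2) has critical group of order 3 (and S_3 also attains order 3). *)

(* Defs.v *)
From HB Require Import structures.
From mathcomp Require Import all_boot all_order all_algebra.
From mathcomp Require Import boolp classical_sets functions cardinality.

Set Implicit Arguments.
Unset Strict Implicit.
Unset Printing Implicit Defensive.

Import Order.TTheory GRing.Theory Num.Theory.

Local Open Scope ring_scope.

(* s_n - 1, where s_n is Sylvester's sequence; indexed from 1, so that
   [sylvester_pred 0 = 0] is a junk value, not related to the recursion. *)
Fixpoint sylvester_pred (n : nat) : nat :=
  if n is m.+1 then
    if m is _.+1 then (sylvester_pred m ^ 2 + sylvester_pred m)%N else 1%N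
  else 0%N.

(* Finite connected loopless undirected multigraphs on the vertex set 'I_m;
   [edges u v] is the number of edges joining u and v. *)
Record graph (m : nat) := Graph {
  edges : 'I_m -> 'I_m -> nat;
  edges_sym : forall u v, edges u v = edges v u;
  edges_loopless : forall v, edges v v = 0%N;
  edges_connected : forall u v, connect (fun x y => (0 < edges x y)%N) u v
}.

Definition adjacency_mx m (G : graph m) : 'M[int]_m :=
  \matrix_(u, v) (edges G u v)%:Z.

Definition arithmetical_structure m (G : graph m) (d r : 'I_m -> nat) : Prop :=
  [/\ forall v, (0 < r v)%N,
      \big[gcdn/0]_v r v = 1%N
    & forall v, (r v * d v = \sum_u edges G v u * r u)%N].

Definition structure_mx m (G : graph m) (d : 'I_m -> nat) : 'M[int]_m :=
  diag_mx (\row_v (d v)%:Z) - adjacency_mx G.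

Section Cokernel.
Variables (m n : nat) (A : 'M[int]_(m, n)).

(* The image of A : Z^n -> Z^m acting on column vectors. *)
Definition mx_image : {pred 'cV[int]_m} := fun x => `[< exists y, x = A *m y >].

Lemma mx_image_zmod_closed : zmod_closed mx_image.
Proof.
split=> [|x y /asboolP[u ->] /asboolP[v ->]]; apply/asboolP.
- by exists 0; rewrite mulmx0.
- by exists (u - v); rewrite mulmxBr.
Qed.

HB.instance Definition _ :=
  GRing.isZmodClosed.Build 'cV[int]_m mx_image mx_image_zmod_closed.

Definition cokernel : zmodType := Quotient.quot mx_image.

End Cokernel.

Section Torsion.
Variable V : zmodType.

Definition is_torsion : {pred V} :=
  fun x => `[< exists k : nat, (0 < k)%N /\ x *+ k = 0 >].

Lemma is_torsion_zmod_closed : zmod_closed is_torsion.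
Proof.
split=> [|x y /asboolP[k [k0 xk]] /asboolP[l [l0 yl]]]; apply/asboolP.
- by exists 1%N; rewrite mul0rn.
- exists (k * l)%N; split; first by rewrite muln_gt0 k0.
  by rewrite mulrnBl mulrnA xk mul0rn mulnC mulrnA yl mul0rn subrr.
Qed.

HB.instance Definition _ :=
  GRing.isZmodClosed.Build V is_torsion is_torsion_zmod_closed.

Record torsion : Type := Torsion { torsion_val : V; _ : is_torsion torsion_val }.

HB.instance Definition _ := [isSub for torsion_val].
HB.instance Definition _ := [Choice of torsion by <:].
HB.instance Definition _ := [SubChoice_isSubZmodule of torsion by <:].

End Torsion.

Definition critical_group m (G : graph m) (d : 'I_m -> nat) : zmodType :=
  torsion (cokernel (structure_mx G d)).

(* K is, up to isomorphism, the critical group of some arithmetical structure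
   on G. *)
Definition is_critical_group m (G : graph m) (K : zmodType) : Prop :=
  exists d r : 'I_m -> nat, arithmetical_structure G d r /\
  exists f : {additive K -> critical_group G d}, bijective f.

Section Families.
Variable n : nat.

(* The star with n leaves: the centre is ord0, the leaves are the nonzero
   ordinals. *)
Definition star_edges (u v : 'I_n.+1) : nat := (u == ord0) (+) (v == ord0).

Lemma star_sym u v : star_edges u v = star_edges v u.
Proof. by rewrite /star_edges addbC. Qed.

Lemma star_loopless v : star_edges v v = 0%N.
Proof. by rewrite /star_edges addbb. Qed.

Lemma star_connected u v : connect (fun x y => (0 < star_edges x y)%N) u v.
Proof.
have c0 x : connect (fun x y => (0 < star_edges x y)%N) x ord0.
  by case: (eqVneq x ord0) => [->|x0] //;
    apply: connect1; rewrite /star_edges (negPf x0) eqxx.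
apply: connect_trans (c0 u) _.
case: (eqVneq v ord0) => [->|v0] //.
by apply: connect1; rewrite /star_edges (negPf v0) eqxx.
Qed.

Definition star_graph : graph n.+1 :=
  Graph star_sym star_loopless star_connected.

Definition complete_edges (u v : 'I_n) : nat := u != v.

Lemma complete_sym u v : complete_edges u v = complete_edges v u.
Proof. by rewrite /complete_edges eq_sym. Qed.

Lemma complete_loopless v : complete_edges v v = 0%N.
Proof. by rewrite /complete_edges eqxx. Qed.

Lemma complete_connected u v :
  connect (fun x y => (0 < complete_edges x y)%N) u v.
Proof.
case: (eqVneq u v) => [->|uv] //.
by apply: connect1; rewrite /complete_edges uv.
Qed.

Definition complete_graph : graph n :=
  Graph complete_sym complete_loopless complete_connected.

End Families.

(* Main.v *)
(* Both kinds of structure come from positive integers e_1 <= ... <= e_n with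
   e_i r_i = R and sum 1/e_i = c an integer: for the star, e_i = d_i on the
   leaves, R = r_0 and c = d_0; for the complete graph, e_i = d_i + 1,
   R = sum r_i and c = 1.  A torsion class is determined by the residues of the
   coordinate differences x_i - x_n modulo e_i for i <= n - 2, so the critical
   group has at most e_1 ... e_(n-2) elements.  By Curtiss' theorem
   c - sum_(i < k) 1/e_i >= 1/a_k, while this remainder is at most
   (n - k + 1)/e_k, so e_k <= (n - k + 1) a_k; finally
   a_1 ... a_(n-3) < a_(n-2). *)
Require Import Defs.
From HB Require Import structures.
From mathcomp Require Import all_boot all_order all_algebra.
From mathcomp Require Import boolp classical_sets functions cardinality.
From mathcomp Require Import perm zify ring lra.

Set Implicit Arguments.
Unset Strict Implicit.
Unset Printing Implicit Defensive.

Import Order.TTheory GRing.Theory Num.Theory.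

Local Open Scope classical_set_scope.
Local Open Scope card_scope.
Local Open Scope ring_scope.

(** * Comparing sums through partial products *)

Lemma abel_sum_ge0 (R : realFieldType) (n : nat) (x u : nat -> R) :
    (forall i, (i < n)%N -> 0 <= x i) ->
    (forall i, (i.+1 < n)%N -> x i.+1 <= x i) ->
    (forall k, (k <= n)%N -> 0 <= \sum_(i < k) u i) ->
  0 <= \sum_(i < n) x i * u i.
Proof.
case: n => [|n] x_ge0 x_dec u_ge0; first by rewrite big_ord0.
(* Summation by parts as an inequality: passing from [x k] to the smaller [x k.+1] in front of a
   nonnegative partial sum only lowers the bound. *)
suff low k : (k <= n)%N ->
    x k * \sum_(i < k.+1) u i <= \sum_(i < k.+1) x i * u i.
  by apply: le_trans (low n _); rewrite ?mulr_ge0 ?x_ge0 ?u_ge0.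
elim: k => [|k IHk] ltkn; first by rewrite !big_ord1.
rewrite big_ord_recr [leRHS]big_ord_recr /= mulrDr lerD2r.
apply: le_trans (IHk (ltnW ltkn)).
by rewrite ler_wpM2r ?x_dec ?u_ge0 // ltnW.
Qed.

(** AM-GM: the n-th power of the mean is at least the product. *)
Lemma sum_ge_card_of_prod_ge1 (R : realFieldType) (n : nat) (t : nat -> R) :
    (forall i, (i < n)%N -> 0 <= t i) -> 1 <= \prod_(i < n) t i ->
  n%:R <= \sum_(i < n) t i.
Proof.
case: n => [|n] t_ge0 prod_ge1; first by rewrite big_ord0.
have [AGM _] := @leif_AGM R 'I_n.+1 predT (fun i => t i)
  (fun i _ => t_ge0 i (ltn_ord i)).
rewrite card_ord in AGM.
have s_ge0 : 0 <= (\sum_(i < n.+1) t i) / n.+1%:R.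
  by rewrite divr_ge0 ?ler0n ?sumr_ge0 // => i _; rewrite t_ge0.
rewrite -[leLHS]mul1r -ler_pdivlMr ?ltr0n //.
rewrite -(@ler_pXn2r _ n.+1) ?nnegrE ?ler01 // expr1n.
exact: le_trans prod_ge1 AGM.
Qed.

(** The sums differ by the sum of x_i (y_i/x_i - 1). By Abel summation, nonnegative partial sums of
    y_i/x_i - 1 suffice, and AM-GM provides these. *)
Lemma ler_sum_of_ler_prod (R : realFieldType) (n : nat) (x y : nat -> R) :
    (forall i, (i < n)%N -> 0 < x i) -> (forall i, (i < n)%N -> 0 <= y i) ->
    (forall i, (i.+1 < n)%N -> x i.+1 <= x i) ->
    (forall k, (k <= n)%N -> \prod_(i < k) x i <= \prod_(i < k) y i) ->
  \sum_(i < n) x i <= \sum_(i < n) y i.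
Proof.
move=> x_gt0 y_ge0 x_dec le_prod.
have -> : \sum_(i < n) y i =
    \sum_(i < n) x i + \sum_(i < n) x i * (y i / x i - 1).
  rewrite -big_split /=; apply: eq_bigr => i _.
  have := x_gt0 i (ltn_ord i); move: (x i) => z z_gt0; field.
  by rewrite gt_eqF.
rewrite lerDl; apply: (@abel_sum_ge0 _ _ x (fun i => y i / x i - 1)) => //.
  by move=> i /x_gt0 /ltW.
move=> k le_kn; rewrite sumrB sumr_const card_ord subr_ge0.
apply: (@sum_ge_card_of_prod_ge1 _ _ (fun i => y i / x i)) => [i ltik|].
  have ltin := leq_trans ltik le_kn.
  by rewrite divr_ge0 ?y_ge0 // ltW ?x_gt0.
rewrite prodf_div ler_pdivlMr ?mul1r ?le_prod //.
by apply: prodr_gt0 => i _; rewrite x_gt0 // (leq_trans (ltn_ord i)).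
Qed.

(** * Telescoping identities for Sylvester's sequence *)

Local Arguments sylvester_pred : simpl never.

Lemma sylvester_predS n : (0 < n)%N ->
  sylvester_pred n.+1 = (sylvester_pred n * (sylvester_pred n).+1)%N.
Proof. by case: n => // n _; rewrite mulnS addnC. Qed.

Lemma sylvester_pred_gt0 n : (0 < n)%N -> (0 < sylvester_pred n)%N.
Proof.
case: n => // n _; elim: n => // n IHn.
by rewrite sylvester_predS // muln_gt0 IHn.
Qed.

(** Telescopes by a_(n+1) = a_n s_n, where s_n = a_n + 1. *)
Lemma prod_sylvester j k :
  (sylvester_pred j.+1 * \prod_(i < k) (sylvester_pred (j + i).+1).+1)%N =
  sylvester_pred (j + k).+1.
Proof.
elim: k => [|k IHk]; first by rewrite big_ord0 muln1 addn0.
by rewrite big_ord_recr /= mulnA IHk addnS -sylvester_predS.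
Qed.

(** Telescopes by 1/s_n = 1/a_n - 1/a_(n+1). *)
Lemma sum_sylvester j k :
  \sum_(i < k) (sylvester_pred (j + i).+1).+1%:R^-1 =
  (sylvester_pred j.+1)%:R^-1 - (sylvester_pred (j + k).+1)%:R^-1 :> rat.
Proof.
elim: k => [|k IHk]; first by rewrite big_ord0 addn0 subrr.
rewrite big_ord_recr /= IHk addnS (@sylvester_predS (j + k).+1) // natrM -natr1.
have : 0 < (sylvester_pred (j + k).+1)%:R :> rat.
  by rewrite ltr0n sylvester_pred_gt0.
move: _%:R (_%:R^-1) => A B A_gt0; field.
by apply/andP; split; lra.
Qed.

(** * Curtiss' theorem on sums of unit fractions *)

Lemma prod_ord_gt0 (n : nat) (e : nat -> nat) :
  (forall i, (i < n)%N -> (0 < e i)%N) -> (0 < \prod_(i < n) e i)%N.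
Proof. by move=> e_gt0; apply: prodn_gt0 => i; apply: e_gt0. Qed.

Lemma sum_inv_common_denom (n : nat) (e : nat -> nat) :
    (forall i, (i < n)%N -> (0 < e i)%N) ->
  exists N : nat,
    \sum_(i < n) (e i)%:R^-1 = N%:R / (\prod_(i < n) e i)%:R :> rat.
Proof.
elim: n => [|n IHn] e_gt0; first by exists 0%N; rewrite !big_ord0 mul0r.
have [N sumE] := IHn (fun i lt_in => e_gt0 i (ltnW lt_in)).
exists (N * e n + \prod_(i < n) e i)%N.
rewrite !big_ord_recr /= sumE natrD !natrM.
have en : (e n)%:R != 0 :> rat by rewrite pnatr_eq0 -lt0n e_gt0.
have p0 : (\prod_(i < n) e i)%:R != 0 :> rat.
  by rewrite pnatr_eq0 -lt0n prod_ord_gt0 // => i /ltnW /e_gt0.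
by field; rewrite en.
Qed.

(** Multiplied by the product of the [e i], both sides of the strict inequality are integers, so
    they differ by at least 1. *)
Lemma sum_inv_lt_nat (n c : nat) (e : nat -> nat) :
    (forall i, (i < n)%N -> (0 < e i)%N) ->
    \sum_(i < n) (e i)%:R^-1 < c%:R :> rat ->
  \sum_(i < n) (e i)%:R^-1 <= c%:R - (\prod_(i < n) e i)%:R^-1 :> rat.
Proof.
move=> e_gt0; have [N ->] := sum_inv_common_denom e_gt0.
have p_gt0 : 0 < (\prod_(i < n) e i)%:R :> rat.
  by rewrite ltr0n prod_ord_gt0.
rewrite ltr_pdivrMr // ler_pdivrMr // mulrBl mulVf ?gt_eqF //.
by rewrite lerBrDr natr1 -natrM ltr_nat ler_nat.
Qed.

(* Soundararajan's argument: up to the last j with [\prod_(i < j) e i <= a_(j+1)]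
   integrality suffices; past j the partial products of e dominate those of
   Sylvester's sequence, so its sum of reciprocals is the larger one. *)
Lemma sylvester_closest (n c : nat) (e : nat -> nat) :
    (forall i, (i < n)%N -> (0 < e i)%N) ->
    (forall i, (i.+1 < n)%N -> (e i <= e i.+1)%N) ->
    \sum_(i < n) (e i)%:R^-1 < c%:R :> rat ->
  \sum_(i < n) (e i)%:R^-1 <= c%:R - (sylvester_pred n.+1)%:R^-1 :> rat.
Proof.
move=> e_gt0 e_inc sum_lt.
pose P j := (j <= n)%N && (\prod_(i < j) e i <= sylvester_pred j.+1)%N.
have exP : exists j, P j by exists 0%N; rewrite /P big_ord0.
have [j /andP[le_jn Pj] maxj] := ex_maxnP exP (fun j => fun H => proj1 (andP H)).
have prod_gt0 k : (k <= n)%N -> (0 < \prod_(i < k) e i)%N.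
  by move=> le_kn; apply: prod_ord_gt0 => i lt_ik; rewrite e_gt0 ?(leq_trans lt_ik).
rewrite -(subnKC le_jn); set m := (n - j)%N.
rewrite big_split_ord /=.
have head : \sum_(i < j) (e i)%:R^-1 <= c%:R - (sylvester_pred j.+1)%:R^-1 :> rat.
  have : \sum_(i < j) (e i)%:R^-1 <= c%:R - (\prod_(i < j) e i)%:R^-1 :> rat.
    apply: sum_inv_lt_nat => [i ltij|]; first by rewrite e_gt0 ?(leq_trans ltij).
    apply: le_lt_trans sum_lt; rewrite -(subnKC le_jn) big_split_ord /= lerDl.
    by apply: sumr_ge0 => i _; rewrite invr_ge0.
  move/le_trans; apply; rewrite lerB // lef_pV2 ?posrE ?ltr0n ?prod_gt0 //.
    by rewrite ler_nat.
  exact: sylvester_pred_gt0.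
have tail : \sum_(i < m) (e (j + i)%N)%:R^-1 <=
    \sum_(i < m) (sylvester_pred (j + i).+1).+1%:R^-1 :> rat.
  have lt_m i : (i < m)%N -> (j + i < n)%N by rewrite /m; lia.
  apply: (@ler_sum_of_ler_prod _ m (fun i => (e (j + i)%N)%:R^-1)
    (fun i => (sylvester_pred (j + i).+1).+1%:R^-1)).
  - by move=> i /lt_m lt_in; rewrite invr_gt0 ltr0n e_gt0.
  - by move=> i _; rewrite invr_ge0 ler0n.
  - move=> i /lt_m; rewrite addnS => lt_in.
    by rewrite lef_pV2 ?posrE ?ltr0n ?e_gt0 ?ler_nat ?e_inc // ltnW.
  - case=> [|k] le_km; first by rewrite !big_ord0.
    have le_jkn : (j + k.+1 <= n)%N by rewrite /m in le_km; lia.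
    rewrite !prodfV -!natr_prod lef_pV2 ?posrE ?ltr0n.
    + rewrite ler_nat.
      (* Maximality of j gives a_(j+k+2) < e_0 ... e_(j+k). Factoring both sides at j, the bound
         [Pj] lets a_(j+1) cancel. *)
      have : ~~ P (j + k.+1)%N by apply/negP => /maxj; lia.
      rewrite /P le_jkn /= -ltnNge -prod_sylvester big_split_ord /=.
      move=> /ltnW /leq_trans /(_ (leq_mul Pj (leqnn _))).
      by rewrite leq_pmul2l // sylvester_pred_gt0.
    + apply: (prod_ord_gt0 (e := fun i => e (j + i)%N)) => i lt_ik.
      by rewrite e_gt0 ?lt_m ?(leq_trans lt_ik).
    + exact: prodn_gt0.
(* The tail is now at most 1/a_(j+1) - 1/a_(n+1), and 1/a_(j+1) is exactly the gap left by
   [head]. *)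
rewrite sum_sylvester in tail.
by rewrite /= in head tail *; lra.
Qed.

(** * Bounds on the denominators *)

Lemma egyptian_term_bound (n c k : nat) (e : nat -> nat) :
    (forall i, (i < n)%N -> (0 < e i)%N) ->
    (forall i j, (i <= j)%N -> (j < n)%N -> (e i <= e j)%N) ->
    \sum_(i < n) (e i)%:R^-1 = c%:R :> rat -> (k < n)%N ->
  (e k <= (n - k) * sylvester_pred k.+1)%N.
Proof.
move=> e_gt0 e_inc sumE lt_kn.
pose m := (n - k)%N; have nE : n = (k + m)%N by rewrite /m; lia.
have lt_m i : (i < m)%N -> (k + i < n)%N by rewrite /m; lia.
rewrite -/m; move: sumE; rewrite [in \sum_(i < n) _]nE big_split_ord /=.
set S := \sum_(i < k) _; set T := \sum_(i < m) _ => sumE.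
have ek_gt0 := e_gt0 _ lt_kn.
(* A positive tail puts [S] strictly below c, as [sylvester_closest] requires. *)
have T_gt0 : 0 < T.
  have m_gt0 : (0 < m)%N by rewrite /m; lia.
  rewrite /T (bigD1 (Ordinal m_gt0)) //= ltr_pwDl ?invr_gt0 ?ltr0n ?e_gt0 ?lt_m //.
  by apply: sumr_ge0 => i _; rewrite invr_ge0.
have T_le : T <= m%:R / (e k)%:R.
  rewrite mulr_natl -[m in leRHS]card_ord -sumr_const; apply: ler_sum => i _.
  rewrite lef_pV2 ?posrE ?ltr0n ?e_gt0 ?lt_m //.
  by rewrite ler_nat e_inc ?leq_addr ?lt_m.
have S_le : S <= c%:R - (sylvester_pred k.+1)%:R^-1.
  apply: sylvester_closest => [i lt_ik|i lt_ik|].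
  - by rewrite e_gt0 // (ltn_trans lt_ik).
  - by rewrite e_inc // (ltn_trans lt_ik).
  - by rewrite -sumE ltrDl.
have a_gt0 : (0 < sylvester_pred k.+1)%N by exact: sylvester_pred_gt0.
have : (sylvester_pred k.+1)%:R^-1 <= m%:R / (e k)%:R :> rat by lra.
by rewrite ler_pdivlMr ?ltr0n // ler_pdivrMl ?ltr0n // -natrM ler_nat mulnC.
Qed.

(** Induction through a_m^2 <= a_m (a_m + 1) = a_(m+1). It starts at m = 2 because for m = 1 both
    sides equal 1. *)
Lemma prod_sylvester_pred_lt m : (2 <= m)%N ->
  (\prod_(i < m) sylvester_pred i.+1 < sylvester_pred m ^ 2)%N.
Proof.
case: m => [|[|m]] // _; elim: m => [|m IHm].
  by rewrite !big_ord_recr big_ord0.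
rewrite big_ord_recr /= expnS expn1 ltn_pmul2r.
  apply: leq_trans IHm _; rewrite (@sylvester_predS m.+2) // expnS expn1 leq_mul2l.
  by rewrite leqnSn orbT.
exact: sylvester_pred_gt0.
Qed.

(** The product (m+2)(m+1)...3 stops short of 2; this is the origin of the factor n!/2. *)
Lemma prod_sub_fact m :
  ((\prod_(i < m) (m.+2 - i)).*2 = m.+2`!)%N.
Proof.
elim: m => [|m IHm]; first by rewrite big_ord0.
rewrite big_ord_recl /= subn0 factS -IHm -doubleMr.
by congr (_ * _).*2%N; apply: eq_bigr => i _; rewrite subSS.
Qed.

Lemma egyptian_prod_bound (m c : nat) (e : nat -> nat) : (2 <= m)%N ->
    (forall i, (i < m.+2)%N -> (0 < e i)%N) ->
    (forall i j, (i <= j)%N -> (j < m.+2)%N -> (e i <= e j)%N) ->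
    \sum_(i < m.+2) (e i)%:R^-1 = c%:R :> rat ->
  ((\prod_(i < m) e i).*2 < m.+2`! * sylvester_pred m ^ 2)%N.
Proof.
move=> m_ge2 e_gt0 e_inc sumE.
have : (\prod_(i < m) e i <=
    \prod_(i < m) (m.+2 - i) * \prod_(i < m) sylvester_pred i.+1)%N.
  rewrite -big_split /=; apply: leq_prod => i _.
  by apply: (egyptian_term_bound e_gt0 e_inc sumE); have := ltn_ord i; lia.
rewrite -leq_double => /leq_ltn_trans; apply.
by rewrite doubleMl prod_sub_fact ltn_pmul2l ?fact_gt0 ?prod_sylvester_pred_lt.
Qed.

(** * Finite codes by residues *)

Lemma card_of_injective (K : Type) (T : finType) (g : K -> T) : injective g ->
  exists k : nat, [set: K] #= `I_k /\ (k <= #|T|)%N.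
Proof.
move=> g_inj; pose h x : nat := enum_rank (g x).
have h_inj : injective h by move=> x y /ord_inj /enum_rank_inj /g_inj.
have le_T : [set: K] #<= `I_#|T|.
  have /card_eqPle[_] := @inj_card_eq _ _ setT h (fun x y _ _ => @h_inj x y).
  move/card_le_trans; apply; apply: subset_card_le => _ [x _ <-] /=.
  exact: ltn_ord.
have /finite_setP[k Kk] : finite_set [set: K] by apply/finite_set_leP; exists #|T|.
exists k; split=> //; rewrite -card_le_II.
by have /card_eqPle[_ /card_le_trans] := Kk; apply.
Qed.

Lemma monotone_perm n (e : 'I_n -> nat) :
  exists s : 'S_n, forall i j : 'I_n, (i <= j)%N -> (e (s i) <= e (s j))%N.
Proof.
pose t := [tuple e i | i < n].
have /tuple_permP[s sortE] : perm_eq (sort leq t) t by rewrite perm_sort.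
exists s => i j le_ij.
have es k : e (s k) = nth 0%N (sort leq t) k.
  by rewrite sortE -tnth_nth !tnth_mktuple.
rewrite !es; apply: (sorted_leq_nth leq_trans leqnn) => //.
- exact/sort_sorted/leq_total.
- by rewrite inE size_sort size_tuple.
- by rewrite inE size_sort size_tuple.
Qed.

Lemma residue_code n (f : 'I_n -> nat) : (forall i, (0 < f i)%N) ->
  exists (T : finType) (g : ('I_n -> int) -> T), #|T| = (\prod_i f i)%N /\
    forall v w, g v = g w -> forall i, (f i %| v i - w i)%Z.
Proof.
move=> f_gt0.
have lt_f (v : 'I_n -> int) i : (absz (v i %% f i)%Z < f i)%N.
  rewrite -ltz_nat gez0_abs ?modz_ge0 ?ltz_pmod ?ltz_nat //.
  by rewrite -lt0n.
exists {dffun forall i : 'I_n, 'I_(f i)}.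
exists (fun v => [ffun i => Ordinal (lt_f v i)]); split.
  rewrite card_dep_ffun foldrE big_map big_enum /=.
  by apply: eq_bigr => i _; rewrite card_ord.
move=> v w /ffunP eq_vw i; have := eq_vw i; rewrite !ffunE => /(congr1 val) /=.
have f_neq0 : (f i)%:Z != 0 by rewrite -lt0n.
move=> /(congr1 Posz); rewrite !gez0_abs ?modz_ge0 // => /eqP.
by rewrite eqz_mod_dvd.
Qed.

(** Dividing by R turns the relations into an Egyptian fraction, since r_i/R = 1/e_i. The code
    records residues modulo every [e i] except the two largest, at [p] and [q]. *)
Lemma egyptian_code (m c R : nat) (e r : 'I_m.+2 -> nat) : (2 <= m)%N ->
    (0 < R)%N -> (forall i, (r i * e i = R)%N) -> (\sum_i r i = R * c)%N ->
  exists (T : finType) (g : ('I_m.+2 -> int) -> T) (p q : 'I_m.+2),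
    (#|T|.*2 < m.+2`! * sylvester_pred m ^ 2)%N /\
    forall v w, g v = g w ->
      forall i, i != p -> i != q -> (e i %| v i - w i)%Z.
Proof.
move=> m_ge2 R_gt0 reE sumE.
have e_gt0 i : (0 < e i)%N.
  by rewrite lt0n; apply: contraTneq R_gt0 => ei0; rewrite -(reE i) ei0 muln0.
have [s s_inc] := monotone_perm e.
(* [s] sorts [e]. Modulus 1 at the two largest entries makes them contribute a factor 1 to the size
   of the code. *)
pose f i := if (s^-1%g i < m)%N then e i else 1%N.
have [|T [g [cardT gP]]] := @residue_code _ f.
  by move=> i; rewrite /f; case: ifP.
exists T, g, (s (inord m)), (s ord_max); split; last first.
  move=> v w /gP eq_vw i i_p i_q; have := eq_vw i; rewrite /f ifT //.
  have := ltn_ord (s^-1%g i); rewrite ltnS leq_eqVlt => /orP[/eqP iE|].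
    by case/eqP: i_q; apply: (canRL (permKV s)); apply: val_inj.
  rewrite ltnS leq_eqVlt => /orP[/eqP iE|//].
  by case/eqP: i_p; apply: (canRL (permKV s)); apply: val_inj; rewrite /= inordK.
pose E k := e (s (inord k)).
have EE (i : 'I_m.+2) : E i = e (s i) by rewrite /E inord_val.
have -> : #|T| = (\prod_(i < m) E i)%N.
  rewrite cardT (reindex_inj (@perm_inj _ s)) /=.
  rewrite (eq_bigr (fun i : 'I_m.+2 => if (i < m)%N then E i else 1%N));
      last first.
    by move=> i _; rewrite /f permK EE.
  rewrite 2!big_ord_recr /= ltnn ltnNge leqnSn /= !muln1.
  by apply: eq_bigr => i _; rewrite ltn_ord.
apply: (@egyptian_prod_bound m c) => //.
- by move=> i _; apply: e_gt0.
- by move=> i j le_ij lt_j; apply: s_inc; rewrite !inordK // (leq_ltn_trans le_ij).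
have Rn0 : R%:R != 0 :> rat by rewrite pnatr_eq0 -lt0n.
have -> : c%:R = \sum_i (r i)%:R / R%:R :> rat.
  by rewrite -mulr_suml -natr_sum sumE natrM mulrC mulKf.
rewrite [RHS](reindex_inj (@perm_inj _ s)) /=; apply: eq_bigr => i _.
rewrite EE -(reE (s i)) natrM invfM mulrA divff ?mul1r //.
by rewrite pnatr_eq0; apply: contraNneq Rn0 => r0; rewrite -(reE (s i)) r0.
Qed.

(** Divisibility determines [y i] away from [p], and the prescribed total then forces the value at
    [p]. The weighted sum of the [z i] ensures that this value also solves the equation at [p]. *)
Lemma egyptian_solve n (e r : 'I_n -> nat) (R c : nat) (p q : 'I_n)
    (z : 'I_n -> int) (N : int) :
    (0 < R)%N -> (forall i, (r i * e i = R)%N) -> (\sum_i r i = R * c)%N ->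
    (forall i, i != p -> i != q -> (e i %| z i - z q)%Z) ->
    \sum_i (r i)%:Z * z i = R%:Z * N ->
  exists y : 'I_n -> int, (forall i, z i = (e i)%:Z * y i + z q) /\
    \sum_i y i = N - c%:Z * z q.
Proof.
move=> R_gt0 reE sumE dvd_e sumz.
have R_neq0 : R%:Z != 0 by rewrite -lt0n.
pose y i := ((z i - z q) %/ e i)%Z.
have yE i : i != p -> z i = (e i)%:Z * y i + z q.
  move=> ip; rewrite mulrC /y; case: (eqVneq i q) => [->|iq].
    by rewrite subrr div0z mul0r add0r.
  by rewrite divzK ?subrK ?dvd_e.
have sumb : \sum_i (r i)%:Z * (z i - z q) = R%:Z * (N - c%:Z * z q).
  rewrite (eq_bigr (fun i => (r i)%:Z * z i - (r i)%:Z * z q)); last first.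
    by move=> i _; rewrite mulrBr.
  rewrite sumrB sumz -mulr_suml -(big_morph Posz PoszD (erefl 0%:Z)) sumE PoszM.
  by rewrite mulrBr mulrA.
have rb i : i != p -> (r i)%:Z * (z i - z q) = R%:Z * y i.
  by move=> /yE {1}->; rewrite addrK mulrA -PoszM reE.
(* Multiply by [r p]: since r_p e_p = R, this is [sumb] with the terms i != p moved across. *)
have zp : z p - z q = (e p)%:Z * (N - c%:Z * z q - \sum_(i | i != p) y i).
  have rp0 : (r p)%:Z != 0.
    by rewrite -lt0n; move: R_gt0; rewrite -(reE p) muln_gt0 => /andP[].
  apply: (mulfI rp0); rewrite mulrA -PoszM reE [RHS]mulrBr -sumb (bigD1 p) //=.
  by rewrite (eq_bigr _ rb) mulr_sumr addrK.
exists (fun i => if i == p then N - c%:Z * z q - \sum_(i | i != p) y i else y i).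
split=> [i|].
  by case: (eqVneq i p) => [->|/yE //]; rewrite -zp subrK.
rewrite (bigD1 p) //= eqxx -[RHS](subrK (\sum_(i | i != p) y i)).
by congr (_ + _); apply: eq_bigr => i /negPf->.
Qed.

(** * Torsion classes and their representatives *)

Lemma structure_mxE m (G : graph m) (d : 'I_m -> nat) (y : 'cV[int]_m) v :
  (structure_mx G d *m y) v 0 =
  (d v)%:Z * y v 0 - \sum_u (edges G v u)%:Z * y u 0.
Proof.
rewrite /structure_mx mulmxBl mxE mul_diag_mx mxE [X in _ + X]mxE; congr (_ - _).
  by rewrite mxE.
by rewrite mxE; apply: eq_bigr => u _; rewrite mxE.
Qed.

(** By symmetry of the edges, r is in the left kernel of the structure matrix. Some positive
    multiple of a torsion representative lies in the image, so its pairing with r vanishes, and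
    integers have no torsion. *)
Lemma torsion_orthogonal m (G : graph m) (d r : 'I_m -> nat)
    (x : critical_group G d) :
    arithmetical_structure G d r ->
  \sum_v (r v)%:Z * repr (torsion_val x) v 0 = 0.
Proof.
case: x => x /= x_tors [_ _ rdE]; move/asboolP: x_tors => [k [k_gt0 kx0]].
have : repr x *+ k \in mx_image (structure_mx G d).
  rewrite -[repr x *+ k]subr0 Quotient.idealrBE raddfMn /= raddf0 reprK.
  by apply/eqP.
case/asboolP=> y kxE.
suff /eqP : (\sum_v (r v)%:Z * repr x v 0) *+ k = 0.
  by rewrite mulrn_eq0 gtn_eqF //= => /eqP.
rewrite -sumrMnl.
rewrite (eq_bigr (fun v => (r v)%:Z * (structure_mx G d *m y) v 0)); last first.
  by move=> v _; rewrite -kxE mulmxnE mulrnAr.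
rewrite (eq_bigr (fun v => \sum_u (edges G v u * r u)%N%:Z * y v 0
   - \sum_u (r v * edges G v u)%N%:Z * y u 0)); last first.
  move=> v _; rewrite structure_mxE mulrBr mulrA -PoszM rdE.
  rewrite mulr_sumr -mulr_suml (big_morph Posz PoszD (erefl 0%:Z)).
  by congr (_ - _); apply: eq_bigr => u _; rewrite mulrA -PoszM.
rewrite sumrB [X in _ - X]exchange_big /=; apply/eqP; rewrite subr_eq0; apply/eqP.
by apply: eq_bigr => v _; apply: eq_bigr => u _; rewrite mulnC edges_sym.
Qed.

(** Representatives of torsion classes are orthogonal to r, so it is enough that [g] separates
    vectors modulo the image when their difference is orthogonal to r. *)
Lemma card_critical_group_le m (G : graph m) (d r : 'I_m -> nat) (T : finType)
    (g : ('I_m -> int) -> T) :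
    arithmetical_structure G d r ->
    (forall v w, \sum_i (r i)%:Z * (v i - w i) = 0 -> g v = g w ->
      exists y : 'I_m -> int, forall i,
        v i - w i = (d i)%:Z * y i - \sum_u (edges G i u)%:Z * y u) ->
  exists k : nat, [set: critical_group G d] #= `I_k /\ (k <= #|T|)%N.
Proof.
move=> dr gP.
apply: (@card_of_injective (critical_group G d) _
  (fun x => g (fun i => repr (torsion_val x) i 0))).
move=> x1 x2 /gP -/(_ _)[|y yP].
  rewrite (eq_bigr (fun i => (r i)%:Z * repr (torsion_val x1) i 0 -
    (r i)%:Z * repr (torsion_val x2) i 0)); last by move=> i _; rewrite mulrBr.
  by rewrite sumrB !torsion_orthogonal ?subrr.
apply: val_inj => /=; rewrite -[LHS]reprK -[RHS]reprK; apply/eqP.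
rewrite -Quotient.idealrBE; apply/asboolP; exists (\col_i y i).
apply/matrixP=> i j; rewrite ord1 structure_mxE !mxE yP.
by congr (_ - _); apply: eq_bigr => u _; rewrite mxE.
Qed.

(** * Stars and complete graphs *)

Lemma card_star_critical_group (m : nat) (d r : 'I_m.+3 -> nat) : (2 <= m)%N ->
    arithmetical_structure (star_graph m.+2) d r ->
  exists k : nat, [set: critical_group (star_graph m.+2) d] #= `I_k /\
    (k.*2 < m.+2`! * sylvester_pred m ^ 2)%N.
Proof.
move=> m_ge2 dr; have [r_gt0 _ rdE] := dr.
pose l (i : 'I_m.+2) := lift ord0 i.
have reE i : (r (l i) * d (l i) = r ord0)%N.
  by rewrite rdE big_ord_recl /= mul1n big1 ?addn0.
have sumE : (\sum_i r (l i) = r ord0 * d ord0)%N.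
  rewrite rdE [RHS]big_ord_recl /= mul0n add0n.
  by apply: eq_bigr => i _; rewrite mul1n.
have [T [g [p [q [cardT gP]]]]] := egyptian_code m_ge2 (r_gt0 ord0) reE sumE.
have [|k [Kk le_kT]] := @card_critical_group_le _ _ _ _ T
    (fun v => g (fun i => v (l i) - v (l q))) dr; last first.
  by exists k; split=> //; apply: leq_ltn_trans cardT; rewrite leq_double.
move=> v w sum0 eq_g; pose z i := v (l i) - w (l i).
(* The choice of N is orthogonality to r with the central term, of weight R = r_0, moved across. *)
have [|| y [yE sumy]] := @egyptian_solve _ _ _ _ _ p q z (- (v ord0 - w ord0))
    (r_gt0 ord0) reE sumE.
- move=> i i_p i_q; have := gP _ _ eq_g i i_p i_q.
  by rewrite /z; congr (_ %| _)%Z; ring.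
- move: sum0; rewrite big_ord_recl /= => /eqP.
  by rewrite addr_eq0 => /eqP sum0; rewrite mulrN sum0 opprK.
(* With -z_q at the centre, row j of a leaf reads d_j y_j + z_q = z_j, and the central row reduces
   to the prescribed sum of the y_j. *)
exists (fun i => if unlift ord0 i is Some j then y j else - z q) => i.
case: (unliftP ord0 i) => [j ->|->]; rewrite big_ord_recl /= unlift_none.
- rewrite mul1r big1 ?addr0 => [|u _]; last by rewrite mul0r.
  by rewrite -/(z j) yE opprK.
- rewrite mul0r add0r (eq_bigr y) => [|u _]; last by rewrite liftK mul1r.
  by rewrite sumy; ring.
Qed.

Lemma card_complete_critical_group (m : nat) (d r : 'I_m.+2 -> nat) :
    (2 <= m)%N -> arithmetical_structure (complete_graph m.+2) d r ->
  exists k : nat, [set: critical_group (complete_graph m.+2) d] #= `I_k /\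
    (k.*2 < m.+2`! * sylvester_pred m ^ 2)%N.
Proof.
move=> m_ge2 dr; have [r_gt0 _ rdE] := dr.
pose R := (\sum_i r i)%N.
have R_gt0 : (0 < R)%N by rewrite /R (bigD1 ord0) //= addn_gt0 r_gt0.
(* Adding r_i to both sides of the equation at i completes its right-hand side to the full sum. *)
have reE i : (r i * (d i).+1 = R)%N.
  rewrite mulnS rdE /R [RHS](bigD1 i) //=; congr (_ + _)%N.
  rewrite [RHS]big_mkcond; apply: eq_bigr => u _.
  by rewrite /= /complete_edges eq_sym; case: eqP => /=; rewrite ?mul1n.
have sumE : (\sum_i r i = R * 1)%N by rewrite muln1.
have [T [g [p [q [cardT gP]]]]] := egyptian_code m_ge2 R_gt0 reE sumE.
have [|k [Kk le_kT]] := @card_critical_group_le _ _ _ _ T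
    (fun v => g (fun i => v i - v q)) dr; last first.
  by exists k; split=> //; apply: leq_ltn_trans cardT; rewrite leq_double.
move=> v w sum0 eq_g; pose z i := v i - w i.
have [|| y [yE sumy]] := @egyptian_solve _ _ _ _ _ p q z 0 R_gt0 reE sumE.
- move=> i i_p i_q; have := gP _ _ eq_g i i_p i_q.
  by rewrite /z; congr (_ %| _)%Z; ring.
- by rewrite mulr0.
exists y => i; rewrite -/(z i) yE.
(* The extra y_i raises the coefficient d_i to e_i = d_i + 1, while the full sum of y equals
   -z_q. *)
have -> : \sum_u (complete_edges i u)%:Z * y u = \sum_u y u - y i.
  rewrite [in RHS](bigD1 i) //= addrAC subrr add0r [RHS]big_mkcond.
  apply: eq_bigr => u _; rewrite /complete_edges eq_sym.
  by case: eqP => _; rewrite ?mul1r ?mul0r.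
by rewrite sumy -addn1 PoszD; ring.
Qed.

Theorem theorem23 (n : nat) (K : zmodType) (n_ge4 : (4 <= n)%N)
    (critK : is_critical_group (star_graph n) K \/
             is_critical_group (complete_graph n) K) :
  exists k : nat, [set: K] #= `I_k /\
    (k%:R < n`!%:R / 2%:R * (sylvester_pred (n - 2))%:R ^+ 2 :> rat).
Proof.
case: n n_ge4 critK => [|[|m]] // m_ge2 critK; rewrite subSS subSS subn0.
(* The rational bound is doubled to become an inequality in nat, with m = n - 2. *)
suff [k [Kk lt_k]] : exists k : nat, [set: K] #= `I_k /\
    (k.*2 < m.+2`! * sylvester_pred m ^ 2)%N.
  exists k; split=> //; rewrite mulrAC ltr_pdivlMr ?ltr0n //.
  by rewrite -natrX -!natrM ltr_nat muln2.
have transport (V : Type) (f : K -> V) (P : nat -> Prop) : bijective f ->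
    (exists k, [set: V] #= `I_k /\ P k) -> exists k, [set: K] #= `I_k /\ P k.
  move=> f_bij [k [Vk Pk]]; exists k; split=> //.
  have [f' fK f'K] := f_bij; apply: card_eq_trans Vk.
  have -> : [set: V] = f @` [set: K].
    by apply/seteqP; split=> // y _; exists (f' y).
  by apply/card_esym/inj_card_eq => x y _ _; apply: can_inj fK _ _.
case: critK => [] [d [r [dr [f f_bij]]]]; apply: (transport _ f) => //.
- exact: card_star_critical_group dr.
- exact: card_complete_critical_group dr.
Qed.
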